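(* Let $\kappa\in\{+1,0,-1\}$, let $R=R(t)$ be the scale factor, and let $g$ be the Robertson-Walker metric $$g=-(\theta^0)^2+(\theta^1)^2+(\theta^2)^2+(\theta^3)^2$$ on $M$, where $\theta^0=\mathrm{d}t$ and $\theta^i=\dfrac{R\,\mathrm{d}x^i}{1+\frac{\kappa}{4}(x^2+y^2+z^2)}$, $i=1,2,3$, with $(x^1,x^2,x^3)=(x,y,z)$. For every real constant $s$ (with $1-sR^2\neq 0$ on $M$), the metric $$\tilde g=-\frac{(\theta^0)^2}{(1-sR^2)^2}+\frac{(\theta^1)^2}{1-sR^2}+\frac{(\theta^2)^2}{1-sR^2}+\frac{(\theta^3)^2}{1-sR^2}$$ has on $M$ the same unparametrised geodesics as $g$.
   Context: $M$ is a 4-dimensional manifold with coordinates $(t,x,y,z)$: $t$ ranges over an open interval on which $R=R(t)$ is a smooth nowhere vanishing (say positive) real function, and $(x,y,z)$ ranges over the region of $\mathbb{R}^3$ where $1+\frac{\kappa}{4}(x^2+y^2+z^2)>0$. Two pseudo-Riemannian metrics on $M$ have the same unparametrised geodesics if every geodesic of the Levi-Civita connection of one is, after a suitable reparametrisation, a geodesic of the Levi-Civita connection of the other, and vice versa. *)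

(* Defs.v *)
From HB Require Import structures.
From mathcomp Require Import all_boot all_order all_algebra.
From mathcomp Require Import all_classical all_reals all_analysis.
From mathcomp Require Import ring lra.

Set Implicit Arguments.
Unset Strict Implicit.
Unset Printing Implicit Defensive.

Import Order.TTheory GRing.Theory Num.Theory.
Import numFieldNormedType.Exports.

Local Open Scope classical_set_scope.
Local Open Scope ring_scope.

Definition open_interval (K : realType) (J : set K) : Prop :=
  open J /\ is_interval J.

(* [C^oo] on the open set [U]: every iterated directional derivative
   [D_(v_k) ... D_(v_1) f] is differentiable at every point of [U]. *)
Definition smooth (K : realType) (V W : normedModType K) (U : set V)
    (f : V -> W) : Prop :=
  forall (vs : seq V) (p : V), U p ->
    differentiable (foldl (fun h v => 'D_v h) f vs) p.

Section Geometry.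
Context (K : realType).

(* Points and tangent vectors of an open subset of R^4 are row vectors in the
   global chart; a metric is its matrix of components in that chart. *)
Notation point := 'rV[K]_4.
Notation metric := ('rV[K]_4 -> 'M[K]_4).

Definition partial (i : 'I_4) (f : point -> K) : point -> K :=
  'D_(delta_mx 0 i) f.

(* On a connected [M], such as Robertson-Walker space-time, continuity and
   nondegeneracy make the signature constant. *)
Definition pseudo_riemannian (M : set point) (g : metric) : Prop :=
  smooth M g /\ forall p, M p -> (g p)^T = g p /\ g p \in unitmx.

(* Christoffel symbol [Gamma^k_ij] of the Levi-Civita connection. *)
Definition christoffel (g : metric) (p : point) (k i j : 'I_4) : K :=
  2^-1 * \sum_l invmx (g p) k l *
    (partial i (fun q => g q j l) p + partial j (fun q => g q i l) p
     - partial l (fun q => g q i j) p).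

Definition geodesic (M : set point) (g : metric) (J : set K)
    (c : K -> point) : Prop :=
  [/\ smooth J c,
      forall u, J u -> M (c u)
    & forall u, J u -> forall k : 'I_4,
        (derive1n 2 c u) 0 k
        + \sum_i \sum_j christoffel g (c u) k i j
                        * (derive1 c u) 0 i * (derive1 c u) 0 j = 0].

Definition reparametrisation (J J' : set K) (phi : K -> K) : Prop :=
  [/\ smooth J' phi, set_bij J' J phi & forall v, J' v -> derive1 phi v != 0].

Definition geodesics_reparametrise (M : set point) (g g' : metric) : Prop :=
  forall (J : set K) (c : K -> point),
    open_interval J -> geodesic M g J c ->
    exists (J' : set K) (phi : K -> K),
      [/\ open_interval J', reparametrisation J J' phi
        & geodesic M g' J' (c \o phi)].

Definition same_unparametrised_geodesics (M : set point) (g g' : metric) :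
    Prop :=
  [/\ pseudo_riemannian M g, pseudo_riemannian M g',
      geodesics_reparametrise M g g' & geodesics_reparametrise M g' g].

(* Torsion-free and compatible with [g]. *)
Definition levi_civita_at (g : metric) (p : point)
    (Gamma : 'I_4 -> 'I_4 -> 'I_4 -> K) : Prop :=
  (forall k i j, Gamma k i j = Gamma k j i) /\
  (forall m i j, partial m (fun q => g q i j) p =
     \sum_l (Gamma l m i * g p l j + Gamma l m j * g p i l)).

Lemma levi_civitaP (M : set point) (g : metric) (p : point)
    (Gamma : 'I_4 -> 'I_4 -> 'I_4 -> K) :
  open M -> pseudo_riemannian M g -> M p ->
  levi_civita_at g p Gamma <-> Gamma = christoffel g p.
Proof.
move=> oM [_ mg] Mp; have [gT gU] := mg _ Mp.
have gC q i j : M q -> g q i j = g q j i.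
  by move=> Mq; have [e _] := mg _ Mq; rewrite -{1}e mxE.
have dC l i j : partial l (fun q => g q i j) p = partial l (fun q => g q j i) p.
  apply: near_eq_derive.
  have nM : nbhs p M by exact: open_nbhs_nbhs.
  by apply: filterS nM => q Mq; exact: gC.
have lower (G : 'I_4 -> 'I_4 -> 'I_4 -> K) i j k :
    \sum_l g p k l * G l i j = (g p *m \col_l G l i j) k 0.
  by rewrite mxE; apply: eq_bigr => l _; rewrite mxE.
pose koszul i j k := 2^-1 * (partial i (fun q => g q j k) p
  + partial j (fun q => g q i k) p - partial k (fun q => g q i j) p).
have chrE i j : \col_l christoffel g p l i j
    = invmx (g p) *m \col_k koszul i j k.
  apply/colP => k; rewrite !mxE /christoffel mulr_sumr; apply: eq_bigr => l _.
  by rewrite !mxE /koszul; ring.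
have chr_lower i j k : \sum_l g p k l * christoffel g p l i j = koszul i j k.
  by rewrite lower chrE mulKVmx // mxE.
split=> [[tf mc]|->].
  apply/funext => k; apply/funext => i; apply/funext => j.
  have lowE a b c : \sum_l g p c l * Gamma l a b = koszul a b c.
    have sE m x y : partial m (fun q => g q x y) p =
        \sum_l g p y l * Gamma l m x + \sum_l g p x l * Gamma l m y.
      rewrite mc -big_split /=; apply: eq_bigr => l _.
      by rewrite (gC p y l Mp); ring.
    have tfE m x y : \sum_l g p y l * Gamma l m x
                   = \sum_l g p y l * Gamma l x m.
      by apply: eq_bigr => l _; rewrite tf.
    rewrite /koszul !sE (tfE b a) (tfE c a) (tfE c b); lra.
  have : \col_l Gamma l i j = \col_l christoffel g p l i j.
    rewrite chrE -[LHS](mulKmx gU); congr (_ *m _).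
    by apply/colP => c; rewrite -lower lowE mxE.
  by move=> /colP /(_ k); rewrite !mxE.
split=> [k i j|m i j].
  congr (_ * _); apply: eq_bigr => l _; congr (_ * _).
  by rewrite (dC l i j); ring.
rewrite big_split /=.
under eq_bigr do rewrite (gC p _ j Mp) mulrC.
under [X in _ + X]eq_bigr do rewrite mulrC.
by rewrite !chr_lower /koszul (dC i m j) (dC j m i) (dC m j i); lra.
Qed.

End Geometry.

Section RobertsonWalker.
Context (K : realType).
Notation point := 'rV[K]_4.

(* The coordinates (t, x, y, z) are the entries 0, 1, 2, 3, and
   [lift ord0 i] for [i : 'I_3] runs over the spatial indices. *)
Definition time (p : point) : K := p 0 ord0.

Definition rw_factor (kappa : K) (p : point) : K :=
  1 + kappa / 4 * \sum_(i < 3) (p 0 (lift ord0 i)) ^+ 2.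

Definition spacetime (kappa : K) (I : set K) : set point :=
  [set p | I (time p) /\ 0 < rw_factor kappa p].

(* A covector is the row of its components in the coordinate coframe. *)
Definition dx (a : 'I_4) : 'rV[K]_4 := delta_mx 0 a.

Definition sq (w : 'rV[K]_4) : 'M[K]_4 := w^T *m w.

Definition theta0 (p : point) : 'rV[K]_4 := dx ord0.

Definition theta (kappa : K) (R : K -> K) (i : 'I_3) (p : point) :
    'rV[K]_4 :=
  (R (time p) / rw_factor kappa p) *: dx (lift ord0 i).

Definition rw_metric (kappa : K) (R : K -> K) (p : point) : 'M[K]_4 :=
  - sq (theta0 p) + \sum_(i < 3) sq (theta kappa R i p).

Definition rw_metric_tilde (kappa : K) (R : K -> K) (s : K) (p : point) :
    'M[K]_4 :=
  let f := 1 - s * R (time p) ^+ 2 in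
  - ((f ^+ 2)^-1 *: sq (theta0 p))
  + \sum_(i < 3) f^-1 *: sq (theta kappa R i p).

End RobertsonWalker.

(* Main.v *)
(* The two Levi-Civita connections differ by a projective change: with
   f = 1 - s R^2 and psi = - df / (2 f),
   Gamma~^k_ij = Gamma^k_ij + delta^k_i psi_j + delta^k_j psi_i.
   A geodesic c of g therefore becomes a geodesic c o phi of g~ as soon as
   phi' = f(t(c o phi)). Such a phi is the inverse of an antiderivative of
   1 / f(t(c)). The opposite direction is the same statement with 1 / f in place
   of f. *)

Require Import Defs.
From mathcomp Require Import all_boot all_order all_algebra.
From mathcomp Require Import all_classical all_reals all_analysis.
From mathcomp Require Import ring lra.
Import Order.TTheory GRing.Theory Num.Theory.
Import numFieldNormedType.Exports.
Local Open Scope classical_set_scope.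
Local Open Scope ring_scope.

Set Implicit Arguments.
Unset Strict Implicit.
Unset Printing Implicit Defensive.

(** The differential of [f] at [x] also gives a first-order expansion of [g], because the two
    remainders agree near 0. Uniqueness of the differential then identifies it with that of [g]. *)
Lemma near_eq_differentiable (K : realType) (V W : normedModType K)
    (f g : V -> W) (x : V) :
  {near x, f =1 g} -> differentiable f x -> differentiable g x.
Proof.
move=> fg df.
have cdf : continuous ('d f x) by exact: diff_continuous.
have E : g \o shift x = cst (g x) + 'd f x +o_ 0 id.
  apply/eqaddoP => e e0.
  have /eqaddoP /(_ e e0) H := diff_locally df.
  have fg0 : \forall h \near 0, f (h + x) = g (h + x).
    have sx : (h + x) @[h --> (0 : V)] --> x.
      by rewrite -[X in _ --> X]add0r; exact: cvgD cvg_id (cvg_cst x).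
    exact: sx fg.
  by apply: filterS2 fg0 H => h fgh; rewrite !fctE/= fgh (nbhs_singleton fg).
have dgE := diff_unique cdf E.
by apply/diff_locallyP; rewrite dgE; split.
Qed.

(** * Smoothness order by order *)

Section NDifferentiable.
Context (K : realType).
Implicit Types V W : normedModType K.

(** Order-by-order form of [smooth], made for induction on [n]. Level 0 already asks for
    differentiability, so level [n] makes all iterated derivatives up to order [n]
    differentiable. *)
Fixpoint ndifferentiable V W (n : nat) (U : set V) (f : V -> W) : Prop :=
  (forall p, U p -> differentiable f p) /\
  (if n is m.+1 then forall v, ndifferentiable m U ('D_v f) else True).

Lemma ndifferentiable_differentiable V W n (U : set V) (f : V -> W) p :
  ndifferentiable n U f -> U p -> differentiable f p.
Proof. by case: n => [|n] [+ _]; apply. Qed.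

(** Since [foldl] applies the head of the list first, [smooth] and the recursion of
    [ndifferentiable] peel off the same direction at each stage. *)
Lemma smoothP V W (U : set V) (f : V -> W) :
  smooth U f <-> forall n, ndifferentiable n U f.
Proof.
split=> [sf n|nf vs].
  elim: n f sf => [|n IH] f sf;
    (split; first by move=> p Up; exact: (sf [::])) => // v.
  by apply: IH => vs; exact: (sf (v :: vs)).
elim: vs f nf => [|v vs IH] f nf p Up /=.
  exact: ndifferentiable_differentiable (nf 0%N) Up.
by apply: IH Up => n; have [_] := nf n.+1; exact.
Qed.

Lemma ndifferentiableW V W n (U : set V) (f : V -> W) :
  ndifferentiable n.+1 U f -> ndifferentiable n U f.
Proof.
by elim: n f => [|n IH] f [df Df]; split=> // v; exact: IH.
Qed.

(** As [U] is open, agreement on [U] is agreement near each of its points and passes to directional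
    derivatives. A formula for a derivative valid only on [U] can thus stand in for the derivative
    itself. *)
Lemma eq_ndifferentiable V W n (U : set V) (f g : V -> W) :
  open U -> (forall p, U p -> f p = g p) ->
  ndifferentiable n U f -> ndifferentiable n U g.
Proof.
move=> oU; elim: n f g => [|n IH] f g fg [df Df];
  (split; first by move=> p Up; apply: near_eq_differentiable (df p Up);
    apply: filterS (open_nbhs_nbhs (conj oU Up))) => // v.
apply: IH (Df v) => p Up; apply: near_eq_derive.
by apply: filterS (open_nbhs_nbhs (conj oU Up)).
Qed.

Lemma ndifferentiable_cst V W n (U : set V) (a : W) :
  ndifferentiable n U (cst a).
Proof.
elim: n a => [|n IH] a; split=> // v.
suff -> : 'D_v (cst a) = cst (0 : W) :> (V -> W) by [].
by apply/funext => p; rewrite derive_cst.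
Qed.

Lemma ndifferentiableD V W n (U : set V) (f g : V -> W) : open U ->
  ndifferentiable n U f -> ndifferentiable n U g ->
  ndifferentiable n U (f + g).
Proof.
move=> oU; elim: n f g => [|n IH] f g [df Df] [dg Dg];
  (split; first by move=> p Up; exact: differentiableD (df p Up) (dg p Up)) =>
  // v.
apply: eq_ndifferentiable oU _ (IH _ _ (Df v) (Dg v)) => p Up.
by rewrite deriveD//; apply: diff_derivable; [exact: df|exact: dg].
Qed.

Lemma ndifferentiableM V n (U : set V) (f g : V -> K) : open U ->
  ndifferentiable n U f -> ndifferentiable n U g ->
  ndifferentiable n U (fun p => f p * g p).
Proof.
move=> oU; elim: n f g => [|n IH] f g nf ng;
  (split; first by move=> p Up; apply: differentiableM;
    [exact: ndifferentiable_differentiable nf Up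
    |exact: ndifferentiable_differentiable ng Up]) => // v.
(* The product rule keeps one factor undifferentiated in each term; that factor is needed one order
   lower. *)
have [nf' ng'] := (ndifferentiableW nf, ndifferentiableW ng).
move: nf ng => [df Df] [dg Dg].
apply: eq_ndifferentiable oU _ (ndifferentiableD oU
  (IH _ _ nf' (Dg v)) (IH _ _ ng' (Df v))) => p Up.
rewrite (deriveM (f := f) (g := g))//; apply: diff_derivable.
- exact: df.
- exact: dg.
Qed.

(** The derivative of 1/f is -(1/f)^2 times that of f, so it involves 1/f only at the previous
    order, which the induction supplies. *)
Lemma ndifferentiableV V n (U : set V) (f : V -> K) : open U ->
  (forall p, U p -> f p != 0) ->
  ndifferentiable n U f -> ndifferentiable n U (fun p => (f p)^-1).
Proof.
move=> oU f0; elim: n => [|n IH] nf;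
  (split; first by move=> p Up; apply: differentiableV (f0 p Up);
    exact: ndifferentiable_differentiable nf Up) => // v.
have ni := IH (ndifferentiableW nf); move: nf => [df Df].
apply: eq_ndifferentiable oU _ (ndifferentiableM oU
  (ndifferentiable_cst n U (-1 : K)) (ndifferentiableM oU
  (ndifferentiableM oU ni ni) (Df v))) => p Up.
rewrite (deriveV (f := f))//; [|exact: f0|exact/diff_derivable/df].
by rewrite /GRing.scale/= expr2 invfM; ring.
Qed.

Lemma derive_comp V (g : V -> K) (f : K -> K) p v :
  differentiable g p -> differentiable f (g p) ->
  'D_v (f \o g) p = 'D_1 f (g p) * 'D_v g p.
Proof.
move=> dg df; rewrite deriveE; last exact: differentiable_comp.
rewrite diff_comp//= deriveE// [in RHS]deriveE//.
by rewrite -[X in 'd f _ X]mulr1 [LHS]linearZ/= mulrC.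
Qed.

(** By the chain rule the derivative is the product of ['D_1 f \o g] and ['D_v g]. The induction is
    general in [f] because ['D_1 f] takes its place. *)
Lemma ndifferentiable_comp V n (U : set V) (J : set K) (g : V -> K)
    (f : K -> K) : open U -> (forall p, U p -> J (g p)) ->
  ndifferentiable n J f -> ndifferentiable n U g ->
  ndifferentiable n U (f \o g).
Proof.
move=> oU UJ; elim: n f => [|n IH] f nf ng;
  (split; first by move=> p Up; apply: differentiable_comp;
    [exact: ndifferentiable_differentiable ng Up
    |exact: ndifferentiable_differentiable nf (UJ _ Up)]) => // v.
have ng' := ndifferentiableW ng; move: nf ng => [df Df] [dg Dg].
apply: eq_ndifferentiable oU _ (ndifferentiableM oU
  (IH _ (Df 1) ng') (Dg v)) => p Up /=.
by rewrite derive_comp//; [exact: dg|exact/df/UJ].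
Qed.

Lemma differentiable_mxP V m n (f : V -> 'M[K]_(m, n)) p :
  differentiable f p <-> forall i j, differentiable (fun q => f q i j) p.
Proof.
split=> [df i j|df].
  by apply: (differentiable_comp (g := fun N : 'M[K]_(m, n) => N i j)) => //;
    exact: differentiable_coord.
have -> : f = \sum_(i < m) \sum_(j < n) (fun q => f q i j *: delta_mx i j).
  apply/funext => q; rewrite [LHS]matrix_sum_delta fct_sumE.
  by apply: eq_bigr => i _; rewrite fct_sumE.
apply: differentiable_sum => i; apply: differentiable_sum => j.
exact: differentiableZl.
Qed.

(** Taking an entry commutes with ['D_v] wherever the map is differentiable, hence on [U]; agreement
    on the open set [U] is enough to pass to the next order. *)
Lemma ndifferentiable_mxP V m n k (U : set V) (f : V -> 'M[K]_(m, n)) :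
  open U -> ndifferentiable k U f <->
  forall i j, ndifferentiable k U (fun q => f q i j).
Proof.
move=> oU; have DE (h : V -> 'M[K]_(m, n)) v i j p :
    differentiable h p -> ('D_v h p) i j = 'D_v (fun q => h q i j) p.
  by move=> dh; rewrite derive_mx ?mxE//; exact: diff_derivable.
elim: k f => [|k IH] f; split.
- by move=> [df _] i j; split=> // p /df /differentiable_mxP.
- move=> nf; split=> // p Up; apply/differentiable_mxP => i j.
  exact: ndifferentiable_differentiable (nf i j) Up.
- move=> [df Df] i j; split=> [p /df /differentiable_mxP //|v].
  apply: eq_ndifferentiable oU _ ((IH _).1 (Df v) i j) => p Up.
  by rewrite DE//; exact: df.
- move=> nf; have df p : U p -> differentiable f p.
    move=> Up; apply/differentiable_mxP => i j.
    exact: ndifferentiable_differentiable (nf i j) Up.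
  split=> // v; apply/IH => i j; have [_ /(_ v) Df] := nf i j.
  by apply: eq_ndifferentiable oU _ Df => p Up; rewrite DE//; exact: df.
Qed.

End NDifferentiable.

(** * Closure properties of smooth functions *)

Section SmoothClosure.
Context (K : realType) (V : normedModType K) (U : set V) (oU : open U).
Implicit Types f g : V -> K.

Lemma smooth_cst a : smooth U (fun=> a : K).
Proof. by apply/smoothP => n; exact: ndifferentiable_cst. Qed.

Lemma smoothD f g : smooth U f -> smooth U g -> smooth U (fun p => f p + g p).
Proof.
by move=> /smoothP sf /smoothP sg; apply/smoothP => n; exact: ndifferentiableD.
Qed.

Lemma smoothM f g : smooth U f -> smooth U g -> smooth U (fun p => f p * g p).
Proof.
by move=> /smoothP sf /smoothP sg; apply/smoothP => n; exact: ndifferentiableM.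
Qed.

Lemma smoothV f : (forall p, U p -> f p != 0) -> smooth U f ->
  smooth U (fun p => (f p)^-1).
Proof.
by move=> f0 /smoothP sf; apply/smoothP => n; exact: ndifferentiableV.
Qed.

Lemma smoothX f n : smooth U f -> smooth U (fun p => f p ^+ n).
Proof.
move=> sf; elim: n => [|n IH]; first exact: smooth_cst.
by under eq_fun do rewrite exprS; exact: smoothM.
Qed.

Lemma smooth_sum n (F : 'I_n -> V -> K) : (forall i, smooth U (F i)) ->
  smooth U (fun p => \sum_(i < n) F i p).
Proof.
move=> sF; rewrite -fct_sumE; apply: (big_ind (smooth U)) => //.
- exact: smooth_cst.
- exact: smoothD.
Qed.

Lemma smooth_mx m n (f : V -> 'M[K]_(m, n)) :
  (forall i j, smooth U (fun p => f p i j)) -> smooth U f.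
Proof.
move=> sf; apply/smoothP => k; apply: (ndifferentiable_mxP _ _ oU).2 => i j.
exact: (smoothP _ _).1 (sf i j) k.
Qed.

End SmoothClosure.

Section SmoothMaps.
Context (K : realType) (V : normedModType K) (U : set V).

Lemma smooth_coord m n (f : V -> 'M[K]_(m, n)) i j :
  open U -> smooth U f -> smooth U (fun p => f p i j).
Proof.
move=> oU /smoothP sf; apply/smoothP => k.
exact: (ndifferentiable_mxP _ _ oU).1 (sf k) i j.
Qed.

Lemma smooth_comp (J : set K) (g : V -> K) (f : K -> K) : open U ->
  (forall p, U p -> J (g p)) ->
  smooth J f -> smooth U g -> smooth U (f \o g).
Proof.
move=> oU UJ /smoothP sf /smoothP sg; apply/smoothP => n.
exact: (ndifferentiable_comp (J := J)).
Qed.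

End SmoothMaps.

(** * Antiderivatives and inverse functions *)

Section Antiderivative.
Context (K : realType).
Implicit Types (J : set K) (h F : K -> K).

Lemma open_interval_lt J u : open_interval J -> J u -> exists2 a, J a & a < u.
Proof.
move=> [oJ _] Ju; have /nbhs_ballP[e /= e0 eJ] := open_nbhs_nbhs (conj oJ Ju).
exists (u - e / 2); last by lra.
by apply: eJ; rewrite /ball/= opprB addrC subrK gtr0_norm; lra.
Qed.

Lemma open_interval_gt J u : open_interval J -> J u -> exists2 b, J b & u < b.
Proof.
move=> [oJ _] Ju; have /nbhs_ballP[e /= e0 eJ] := open_nbhs_nbhs (conj oJ Ju).
exists (u + e / 2); last by lra.
by apply: eJ; rewrite /ball/= opprD addrA subrr sub0r normrN gtr0_norm; lra.
Qed.

(** The value at [x] is the integral from [u0] to [x], written as a difference of two integrals from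
    a common base point below both, so that every interval of integration is positively oriented. *)
Lemma antiderivative J h : open_interval J ->
  (forall u, J u -> {for u, continuous h}) ->
  exists F, forall u, J u -> is_derive u 1 F (h u).
Proof.
move=> oJ ch; have [J0|] := pselect (exists u, J u); last first.
  by move=> J0; exists 0 => u Ju; exfalso; apply: J0; exists u.
have [u0 Ju0] := J0; have [oJ' iJ] := oJ.
have inth a b : J a -> J b ->
    lebesgue_measure.-integrable `[a, b] (EFin \o h).
  move=> Ja Jb; apply: continuous_compact_integrable.
    exact: segment_compact.
  apply: continuous_in_subspaceT => x; rewrite inE/= in_itv/= => axb.
  exact/ch/(iJ a b).
pose I a x := (\int[lebesgue_measure]_(t in `[a, x]) h t)%R.
have Iadd a b x : J a -> J x -> a <= b <= x -> I a x = I a b + I b x.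
  move=> Ja Jx /andP[ab bx]; apply/eqP; rewrite addrC -subr_eq; apply/eqP.
  rewrite /I Rintegral_itvB ?bnd_simp//; last exact: inth.
  apply: Rintegral_itv_obnd_cbnd; apply: integrableS (inth a x Ja Jx) => //=.
  by apply: subset_itvr; rewrite bnd_simp.
(* The base point moves with [x]: the integral from a fixed base point inside
   [J] would have to be signed. *)
pose low x a := J a /\ a < x /\ a < u0.
have lowE x : J x -> exists a, low x a.
  move=> Jx; have [ux|xu] := leP x u0.
    have [a Ja ax] := open_interval_lt oJ Jx.
    by exists a; split=> //; split=> //; exact: lt_le_trans ux.
  have [a Ja ax] := open_interval_lt oJ Ju0.
  by exists a; split=> //; split=> //; exact: lt_trans xu.
pose F x := let a := get (low x) in I a x - I a u0.
(* Additivity of the integral makes the value independent of the admissible base point. *)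
have FE x a : J x -> low x a -> F x = I a x - I a u0.
  move=> Jx; have [lx1 [lx2 lx3]] := getPex (lowE x Jx); rewrite /F.
  move: (get _) lx1 lx2 lx3 => b Jb bx bu [Ja [ax au]].
  have [ab|/ltW ba] := leP a b.
    by rewrite (Iadd a b x) ?(Iadd a b u0) ?ab ?(ltW bx) ?(ltW bu)//; ring.
  by rewrite (Iadd b a x) ?(Iadd b a u0) ?ba ?(ltW ax) ?(ltW au)//; ring.
exists F => u Ju.
(* A single base point [a] serves all [x] near [u], which brings the fundamental theorem of calculus
   with fixed lower bound into play. *)
have [a [Ja [au au0]]] := lowE u Ju.
have [b Jb ub] := open_interval_gt oJ Ju.
have [dI DI] := continuous_FTC1_closed ub (inth a b Ja Jb) au (ch u Ju).
apply: (@near_eq_is_derive _ _ _ (fun x => I a x - I a u0)).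
  near=> x; rewrite (FE x a)//.
    by near: x; exact: open_nbhs_nbhs.
  by split=> //; split=> //; near: x; exact: lt_nbhsr.
rewrite -[h u]subr0; apply: is_deriveB.
by apply: DeriveDef => //; rewrite -derive1E.
Unshelve. all: by end_near. Qed.

End Antiderivative.

Section InverseFunction.
Context (K : realType).
Implicit Types (J : set K) (h F : K -> K).

(** By the mean value theorem, two distinct points with the same value would enclose a zero of
    [h]. *)
Lemma is_derive_neq0_inj J h F : is_interval J ->
  (forall u, J u -> is_derive u 1 F (h u)) -> (forall u, J u -> h u != 0) ->
  {in J &, injective F}.
Proof.
move=> iJ dF h0 a b; rewrite !inE => Ja Jb Fab.
wlog ab : a b Ja Jb Fab / a < b.
  move=> W; have [ab|ba|//] := ltgtP a b; first exact: W.
  by apply/esym; exact: W.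
have sJ x : x \in `[a, b] -> J x by rewrite in_itv/=; exact: iJ.
have [||c cab /esym/eqP] := @MVT _ F h a b ab.
- by move=> x xab; apply/dF/sJ/subset_itv_oo_cc.
- apply: continuous_in_subspaceT => x; rewrite inE/= => xab.
  by apply/differentiable_continuous/derivable1_diffP; case: (dF _ (sJ _ xab)).
- rewrite Fab subrr mulf_eq0 subr_eq0 (gt_eqF ab) orbF.
  by rewrite (negPf (h0 _ (sJ _ (subset_itv_oo_cc cab)))).
Qed.

(** The image is an interval by continuity. It is open because an extremum of [F] at an interior
    point would force a zero derivative: [F] takes values on both sides of [F u], and the interval
    property fills the gap between them. *)
Lemma is_derive_neq0_image J h F : open_interval J ->
  (forall u, J u -> is_derive u 1 F (h u)) -> (forall u, J u -> h u != 0) ->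
  open_interval (F @` J).
Proof.
move=> oJ dF h0; have [oJ' iJ] := oJ.
have iF : is_interval (F @` J).
  apply/connected_intervalP/connected_continuous_connected.
    exact/connected_intervalP.
  apply: continuous_in_subspaceT => x; rewrite inE/= => Jx.
  by apply/differentiable_continuous/derivable1_diffP; case: (dF _ Jx).
split=> //; rewrite openE => _ [u Ju <-].
have [a Ja au] := open_interval_lt oJ Ju.
have [b Jb ub] := open_interval_gt oJ Ju.
have uab : u \in `]a, b[ by rewrite in_itv/= au ub.
have sJ x : x \in `]a, b[ -> J x.
  by move=> /subset_itv_oo_cc; rewrite /= in_itv/=; exact: iJ.
have dFab x : x \in `]a, b[ -> derivable F x 1.
  by move=> /sJ Jx; case: (dF _ Jx).
have ab := lt_trans au ub.
have Du : ~ is_derive u 1 F 0.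
  move=> D0; have [_ Fh] := dF u Ju; have [_ F0] := D0.
  by move: (h0 u Ju); rewrite -Fh F0 eqxx.
have [y1 [v1 Jv1 <-] lt1] : exists2 y, (F @` J) y & y < F u.
  apply: contrapT => H; apply: Du; apply: (derive1_at_min (ltW ab) dFab uab).
  move=> t /sJ Jt; rewrite leNgt; apply/negP => lt; apply: H.
  by exists (F t) => //; exists t.
have [y2 [v2 Jv2 <-] lt2] : exists2 y, (F @` J) y & F u < y.
  apply: contrapT => H; apply: Du; apply: (derive1_at_max (ltW ab) dFab uab).
  move=> t /sJ Jt; rewrite leNgt; apply/negP => lt; apply: H.
  by exists (F t) => //; exists t.
rewrite /interior/=; near=> y.
apply: (iF (F v1) (F v2)); [by exists v1|by exists v2|].
apply/andP; split; apply: ltW; near: y; [exact: lt_nbhsr|exact: lt_nbhsl].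
Unshelve. all: by end_near. Qed.

Lemma derive_scale1 (W : normedModType K) (f : K -> W) x v :
  differentiable f x -> 'D_v f x = v *: 'D_1 f x.
Proof. by move=> df; rewrite deriveE// diff1E//= derive1E. Qed.

(* [G] solves the autonomous equation [G' = (1 / h) o G], so that each order of
   differentiability of [G] yields the next one. *)
Lemma smooth_inverse J h F : open_interval J -> smooth J h ->
  (forall u, J u -> is_derive u 1 F (h u)) -> (forall u, J u -> h u != 0) ->
  exists G, [/\ smooth (F @` J) G, set_bij (F @` J) J G &
    forall v, (F @` J) v -> is_derive v 1 G (h (G v))^-1].
Proof.
move=> oJ sh dF h0; have [oJ' iJ] := oJ.
have Fi := is_derive_neq0_inj iJ dF h0.
have [oFJ _] := is_derive_neq0_image oJ dF h0.
(* Off the image of [J] the value of [get] is arbitrary; the claims on [G] concern the open image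
   only. *)
pose G (v : K) : K := get [set u | J u /\ F u = v].
have GF u : J u -> G (F u) = u.
  move=> Ju; have [|JG FG] := @getPex _ [set w | J w /\ F w = F u].
    by exists u.
  by apply: Fi; rewrite ?inE.
have dG v : (F @` J) v -> is_derive v 1 G (h (G v))^-1.
  move=> [u Ju <-]; rewrite GF//; apply: is_derive_inverse (dF u Ju) (h0 u Ju).
    by apply: filterS (open_nbhs_nbhs (conj oJ' Ju)).
  apply: filterS (open_nbhs_nbhs (conj oJ' Ju)) => w Jw.
  by apply/differentiable_continuous/derivable1_diffP; case: (dF _ Jw).
have JG v : (F @` J) v -> J (G v) by move=> [u Ju <-]; rewrite GF.
exists G; split=> //.
- have dG' v : (F @` J) v -> differentiable G v.
    by move=> /dG[dGv _]; exact/derivable1_diffP.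
  apply/smoothP; elim=> [|n IH]; split=> // w.
  have nh : ndifferentiable n (F @` J) (fun v => (h (G v))^-1).
    apply: ndifferentiableV => //; first by move=> v /JG; exact: h0.
    by apply: (ndifferentiable_comp (J := J)) => //; exact: (smoothP J h).1.
  apply: eq_ndifferentiable oFJ _
    (ndifferentiableM oFJ (ndifferentiable_cst n _ w) nh) => v Fv /=.
  by have [_ <-] := dG v Fv; rewrite [RHS](derive_scale1 w (dG' v Fv)).
- split=> //.
  + by move=> _ _ /set_mem[u Ju <-] /set_mem[w Jw <-]; rewrite !GF// => ->.
  + by move=> u Ju; exists (F u); [exists u|exact: GF].
Qed.

End InverseFunction.

(** * Projective changes of connection *)

Section ProjectiveChange.
Context (K : realType).
Notation point := 'rV[K]_4.
Notation metric := ('rV[K]_4 -> 'M[K]_4).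
Implicit Types (J : set K) (c : K -> point).

Lemma derive1_coord J c u k : J u -> smooth J c ->
  (derive1 c u) 0 k = 'D_1 (fun w => c w 0 k) u.
Proof.
move=> Ju sc; rewrite derive1E derive_mx ?mxE//.
exact/diff_derivable/(sc [::]).
Qed.

Lemma derive2_coord J c u k : open J -> J u -> smooth J c ->
  (derive1n 2 c u) 0 k = 'D_1 ('D_1 (fun w => c w 0 k)) u.
Proof.
move=> oJ Ju sc.
have -> : derive1n 2 c u = 'D_1 ('D_1 c) u.
  by rewrite /= derive1E; congr ('D_1 _ u); apply/funext => w; rewrite derive1E.
rewrite derive_mx ?mxE; last exact/diff_derivable/(sc [:: 1]).
apply: near_eq_derive; apply: filterS (open_nbhs_nbhs (conj oJ Ju)) => w Jw.
by rewrite -derive1E (derive1_coord _ Jw).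
Qed.

(** Contracting the projective correction twice with a velocity [a] gives a multiple of [a k]. Being
    tangent to the curve, this term can be absorbed by a change of parameter. *)
Lemma sum_delta_quadratic (k l : 'I_4) (a : 'I_4 -> K) :
  \sum_i \sum_j ((k == i)%:R * (j == l)%:R + (k == j)%:R * (i == l)%:R)
    * a i * a j = 2 * a k * a l.
Proof.
have H (k1 k2 : 'I_4) :
    \sum_i \sum_j ((k1 == i)%:R * (j == k2)%:R) * a i * a j = a k1 * a k2.
  rewrite (bigD1 k1)//= (bigD1 k2)//= !eqxx !mul1r !big1 ?addr0//.
  - by move=> i /negPf ik; rewrite big1// => j _; rewrite eq_sym ik !mul0r.
  - by move=> j /negPf jk; rewrite jk mulr0 !mul0r.
have -> : 2 * a k * a l = a k * a l + a l * a k by ring.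
rewrite -!H -big_split; apply: eq_bigr => i _; rewrite -big_split.
apply: eq_bigr => j _ /=.
by rewrite (eq_sym l i) (eq_sym j k); ring.
Qed.

(* Weyl's projective change of connection by the exact one-form
   [psi = - d mu / (2 mu)]: the affine parameter is rescaled by [mu]. *)
Lemma projective_change_reparametrise (M : set point) (g g' : metric)
    (I : set K) (mu : K -> K) :
  smooth I mu -> (forall t, I t -> mu t != 0) ->
  (forall p, M p -> I (time p)) ->
  (forall p k i j, M p -> christoffel g' p k i j = christoffel g p k i j
     - 'D_1 mu (time p) / (2 * mu (time p))
       * ((k == i)%:R * (j == ord0)%:R + (k == j)%:R * (i == ord0)%:R)) ->
  geodesics_reparametrise M g g'.
Proof.
move=> smu mu0 MI chE J c oJ [sc Mc geo]; have [oJ' _] := oJ.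
pose x k (u : K) : K := c u 0 k.
have sx k : smooth J (x k) by exact: smooth_coord.
pose m u := mu (x ord0 u).
have m0 u : J u -> m u != 0 by move=> /Mc/MI; exact: mu0.
have sm : smooth J m by apply: (smooth_comp (J := I)) => // u /Mc/MI.
have sh : smooth J (fun u => (m u)^-1).
  exact: (smoothV oJ' m0 sm).
have h0 u : J u -> (m u)^-1 != 0 by move=> Ju; rewrite invr_eq0 m0.
have [F dF] : exists F, forall u, J u -> is_derive u 1 F (m u)^-1.
  apply: antiderivative => // u Ju.
  exact/differentiable_continuous/(sh [::]).
have [phi [sphi bphi dphi]] := smooth_inverse oJ sh dF h0.
have oFJ := is_derive_neq0_image oJ dF h0; have [oFJ' _] := oFJ.
have Jphi v : (F @` J) v -> J (phi v) by move=> Fv; case: bphi => + _ _; apply.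
have Dphi v : (F @` J) v -> 'D_1 phi v = m (phi v).
  by move=> /dphi[_ ->]; rewrite invrK.
exists (F @` J), phi; split=> //.
  by split=> // v Fv; rewrite derive1E Dphi// m0//; exact: Jphi.
have scphi : smooth (F @` J) (c \o phi).
  apply/smoothP => n; apply: (ndifferentiable_mxP _ _ oFJ').2 => i k.
  rewrite ord1; apply: (ndifferentiable_comp (J := J) (f := x k)) => //.
    exact: (smoothP _ _).1 (sx k) n.
  exact: (smoothP _ _).1 sphi n.
have dphi' v : (F @` J) v -> differentiable phi v by exact: (sphi [::]).
have dy k v : (F @` J) v ->
    'D_1 (x k \o phi) v = m (phi v) * 'D_1 (x k) (phi v).
  move=> Fv; rewrite derive_comp ?Dphi//; [by rewrite mulrC|exact: dphi'|].
  exact/(sx k [::])/Jphi.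
split=> // [v /Jphi/Mc//|v Fv k].
have Ju := Jphi v Fv.
have vel i : (derive1 (c \o phi) v) 0 i = m (phi v) * 'D_1 (x i) (phi v).
  by rewrite (derive1_coord _ Fv scphi); exact: dy.
have {}chE := chE _ _ _ _ (Mc _ Ju).
rewrite (derive2_coord k oFJ' Fv scphi).
under eq_bigr do under eq_bigr do
  rewrite !vel chE.
(* The velocity is [m \o phi] times ['D_1 (x k) \o phi]. Differentiating this product brings out one
   more factor [m], since phi' = m o phi. *)
have -> : 'D_1 ('D_1 (fun w => (c \o phi) w 0 k)) v =
    m (phi v) * (m (phi v) * 'D_1 ('D_1 (x k)) (phi v)
      + 'D_1 mu (x ord0 (phi v)) * 'D_1 (x ord0) (phi v) * 'D_1 (x k) (phi v)).
  have -> : 'D_1 ('D_1 (fun w => (c \o phi) w 0 k)) v =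
      'D_1 ((m \o phi) * ('D_1 (x k) \o phi)) v.
    apply: near_eq_derive; apply: filterS (open_nbhs_nbhs (conj oFJ' Fv)) => w.
    exact: dy.
  have dmphi : differentiable m (phi v) by exact: (sm [::]).
  have dxk : differentiable ('D_1 (x k)) (phi v) by exact: (sx k [:: 1]).
  have dx0 : differentiable (x ord0) (phi v) by exact: (sx ord0 [::]).
  have dmu : differentiable mu (x ord0 (phi v)).
    exact/(smu [::])/MI/Mc.
  have Dm : 'D_1 m (phi v) =
      'D_1 mu (x ord0 (phi v)) * 'D_1 (x ord0) (phi v) by exact: derive_comp.
  have dpv := dphi' v Fv.
  rewrite deriveM; [|by apply/diff_derivable/differentiable_comp..].
  rewrite (derive_comp (1 : K) dpv dmphi) (derive_comp (1 : K) dpv dxk).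
  rewrite Dphi// Dm.
  by rewrite /GRing.scale/=; ring.
pose S := \sum_i \sum_j christoffel g (c (phi v)) k i j
  * 'D_1 (x i) (phi v) * 'D_1 (x j) (phi v).
(* The geodesic equation of [g] at the parameter [phi v] trades the acceleration for the connection
   term. *)
have -> : 'D_1 ('D_1 (x k)) (phi v) = - S.
  apply/eqP; rewrite -addr_eq0; apply/eqP; rewrite -[RHS](geo _ Ju k).
  rewrite (derive2_coord k oJ' Ju sc); congr (_ + _).
  apply: eq_bigr => i _; apply: eq_bigr => j _.
  by rewrite !(derive1_coord _ Ju sc).
set a := fun i => 'D_1 (x i) (phi v).
rewrite [X in _ + X](_ : _ = m (phi v) ^+ 2 * (S -
    'D_1 mu (x ord0 (phi v)) / (2 * m (phi v)) *
    \sum_i \sum_j ((k == i)%:R * (j == ord0)%:R + (k == j)%:R * (i == ord0)%:R)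
      * a i * a j)); last first.
  rewrite mulrBr !mulr_sumr -sumrB; apply: eq_bigr => i _.
  rewrite !mulr_sumr -sumrB; apply: eq_bigr => j _.
  by rewrite /a /m /time /x; ring.
(* The correction contributes -m^2 (mu'/(2m)) 2 a_k a_0 = -m mu' a_0 a_k, which cancels the term
   coming from the derivative of [m]. *)
rewrite sum_delta_quadratic /a; field.
exact: m0.
Qed.

End ProjectiveChange.

(** * Coordinate functions and Christoffel symbols of diagonal metrics *)

Section Coordinates.
Context (K : realType).
Notation point := 'rV[K]_4.

Lemma derive_coord (i : 'I_4) v (p : point) :
  'D_v (fun q : point => q 0 i) p = v 0 i.
Proof.
have := @derive_mx K point 1 4 id p v (@derivable_id _ _ p v).
by rewrite derive_id => /matrixP /(_ 0 i); rewrite mxE => ->.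
Qed.

Lemma smooth_coordinate (U : set point) (i : 'I_4) :
  smooth U (fun p : point => p 0 i).
Proof.
apply/smoothP => -[|n];
  (split; first by move=> p _; exact: differentiable_coord) => // v.
 rewrite (_ : 'D_v _ = cst (v 0 i)); first exact: ndifferentiable_cst.
by apply/funext => p; rewrite derive_coord.
Qed.

Lemma partial_time_comp (i : 'I_4) (f : K -> K) (p : point) :
  differentiable f (time p) ->
  partial i (f \o @time K) p = (i == ord0)%:R * 'D_1 f (time p).
Proof.
move=> df; rewrite /partial derive_comp//; last exact: differentiable_coord.
by rewrite derive_coord mxE eqxx/= eq_sym mulrC.
Qed.

(** The inverse of a diagonal metric is diagonal, so only the term l = k of the sum over [l]
    survives. *)
Lemma christoffel_diag (g : point -> 'M[K]_4) (d : point -> 'rV[K]_4) p k i j :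
  (forall q, g q = diag_mx (d q)) -> (forall l, d p 0 l != 0) ->
  christoffel g p k i j = (2 * d p 0 k)^-1 *
    ((j == k)%:R * partial i (fun q => d q 0 k) p
     + (i == k)%:R * partial j (fun q => d q 0 k) p
     - (i == j)%:R * partial k (fun q => d q 0 i) p).
Proof.
move=> gE d0.
have pE l a b : partial l (fun q => g q a b) p =
    (a == b)%:R * partial l (fun q => d q 0 a) p.
  rewrite /partial; under eq_fun do rewrite gE mxE.
  have [_|_] := eqVneq a b; first by rewrite mul1r.
  by under eq_fun do rewrite mulr0n; rewrite derive_cst mul0r.
have gU : g p \in unitmx.
  by rewrite gE unitmxE det_diag unitfE; apply/prodf_neq0 => l _.
have iE l : invmx (g p) k l = (k == l)%:R / d p 0 l.
  apply: (mulIf (d0 l)); rewrite divfK//.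
  have /matrixP /(_ k l) := mulVmx gU; rewrite !mxE => <-.
  rewrite (bigD1 l)//= gE mxE eqxx mulr1n big1 ?addr0// => m ml.
  by rewrite mxE (negPf ml) mulr0n mulr0.
rewrite /christoffel (bigD1 k)//= big1 ?addr0; last first.
  by move=> l lk; rewrite iE eq_sym (negPf lk) !mul0r.
rewrite iE eqxx !pE div1r mulrA -invfM.
(* Under the Kronecker delta the entry differentiated may be renamed from [j], and likewise from
   [i], to [k]. *)
have dl l : (j == k)%:R * partial l (fun q => d q 0 j) p =
    (j == k)%:R * partial l (fun q => d q 0 k) p.
  by case: eqP => [->//|_]; rewrite !mul0r.
have dm l : (i == k)%:R * partial l (fun q => d q 0 i) p =
    (i == k)%:R * partial l (fun q => d q 0 k) p.
  by case: eqP => [->//|_]; rewrite !mul0r.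
by rewrite dl dm.
Qed.

End Coordinates.

(** * The Robertson-Walker metrics *)

(* [christoffel_rw_tilde] with the derivatives abstracted: [c l] and
   [rho l * c l] are the diagonal entries of g and g~, [D a l] = d_a c_l,
   [r] = R and [r'] = R'. Only the time derivatives of [c] enter, so those of
   the spatial factor 1 + kappa |x|^2 / 4 need not be computed. *)
Lemma rw_christoffel_algebra (K : realType) (c rho : 'I_4 -> K)
    (D : 'I_4 -> 'I_4 -> K) (r r' s f : K) (k i j : 'I_4) :
  r != 0 -> f != 0 -> f = 1 - s * r ^+ 2 ->
  rho ord0 = f ^- 2 -> (forall l, l != ord0 -> rho l = f^-1) ->
  c ord0 = -1 -> (forall l, c l != 0) ->
  (forall l, D l ord0 = 0) ->
  (forall l, l != ord0 -> D ord0 l = 2 * r' / r * c l) ->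
  let rho' l := (if l == ord0 then 2 else 1) * (2 * s * r * r') / f * rho l in
  (2 * (rho k * c k))^-1 *
    ((j == k)%:R * (rho k * D i k + (i == ord0)%:R * rho' k * c k)
     + (i == k)%:R * (rho k * D j k + (j == ord0)%:R * rho' k * c k)
     - (i == j)%:R * (rho i * D k i + (k == ord0)%:R * rho' i * c i)) =
  (2 * c k)^-1 *
    ((j == k)%:R * D i k + (i == k)%:R * D j k - (i == j)%:R * D k i)
  - - (2 * s * r * r') / (2 * f)
    * ((k == i)%:R * (j == ord0)%:R + (k == j)%:R * (i == ord0)%:R).
Proof.
move=> r0 f0 fE rho0 rhoE c0 cN0 D0 D0E /=.
have ne (a b : 'I_4) : a != b -> ((a == b) = false) * ((b == a) = false).
  by move=> ab; rewrite (eq_sym b) (negPf ab).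
have [->|k0] := eqVneq k ord0; have [->|i0] := eqVneq i ord0;
  have [->|j0] := eqVneq j ord0; rewrite ?eqxx ?D0 ?rho0 ?c0;
  rewrite ?(ne _ _ k0) ?(ne _ _ i0) ?(ne _ _ j0) ?rhoE// /=.
- by field.
- by field.
- by field.
(* Here [k] is the time index while [i] and [j] are spatial. The projective correction vanishes, so
   Gamma^0_ii must be the same for both metrics; this is where f + s r^2 = 1 enters. *)
- have [->|ij] := eqVneq i j; rewrite ?eqxx ?(ne _ _ ij) ?D0E// /=.
    have s2 : s * r ^+ 2 = 1 - f by rewrite fE; ring.
    have -> : 2 * s * r * r' = 2 * r' / r * (1 - f) by rewrite -s2; field.
    by field; rewrite ?r0 ?f0 ?cN0.
  by field; rewrite ?f0 ?cN0.
- by field; rewrite ?f0 ?cN0.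
- have [->|jk] := eqVneq j k; rewrite ?eqxx ?(ne _ _ jk) ?D0E// /=;
    by field; rewrite ?f0 ?cN0 ?r0.
- have [->|ik] := eqVneq i k; rewrite ?eqxx ?(ne _ _ ik) ?D0E// /=;
    by field; rewrite ?f0 ?cN0 ?r0.
- by have [->|ij] := eqVneq i j; field; rewrite ?f0 ?cN0.
Qed.

Section RobertsonWalker.
Context (K : realType) (kappa : K) (I : set K) (R : K -> K) (s : K).
Notation point := 'rV[K]_4.
Notation M := (spacetime kappa I).

Definition rw_coef (p : point) : 'rV[K]_4 :=
  \row_k if k == ord0 then -1 else (R (time p) / rw_factor kappa p) ^+ 2.

(** Ratio of the diagonal entries of g~ and g. Its dependence on time alone confines the new
    derivative terms to the time direction. *)
Definition tilde_factor (k : 'I_4) (t : K) : K :=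
  let f := 1 - s * R t ^+ 2 in if k == ord0 then (f ^+ 2)^-1 else f^-1.

Lemma sum_sq_theta p a b :
  (\sum_(i < 3) sq (theta kappa R i p)) a b =
  (if a == ord0 then 0 else (R (time p) / rw_factor kappa p) ^+ 2) *+ (a == b).
Proof.
rewrite summxE; under eq_bigr do
  rewrite /sq /theta mxE big_ord1 !mxE !eqxx/=.
have [->|a0] := eqVneq a ord0.
  by rewrite mul0rn big1// => i _; rewrite (negPf (neq_lift _ _)) mulr0 mul0r.
have [i ->] : exists i, a = lift ord0 i.
  by case: (unliftP ord0 a) a0 => [i ->|->]; [exists i|rewrite eqxx].
rewrite (bigD1 i)//= eqxx mulr1 big1 ?addr0; last first.
  by move=> j ji; rewrite (inj_eq lift_inj) eq_sym (negPf ji) mulr0 mul0r.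
by rewrite (eq_sym b); case: eqP => _; rewrite ?mulr1 ?mulr0// expr2.
Qed.

Lemma sq_theta0 (p : point) a b :
  sq (theta0 p) a b = (a == ord0)%:R *+ (a == b).
Proof.
rewrite /sq /theta0 mxE big_ord1 !mxE !eqxx/=.
have [->|a0] := eqVneq a ord0; last by rewrite mul0r mul0rn.
by rewrite mul1r eq_sym.
Qed.

Lemma rw_metricE p : rw_metric kappa R p = diag_mx (rw_coef p).
Proof.
apply/matrixP => a b; rewrite /rw_metric [LHS]mxE [X in X + _]mxE.
rewrite sum_sq_theta sq_theta0 !mxE.
by have [->|a0] := eqVneq a ord0; rewrite ?mul0rn ?addr0 ?oppr0 ?add0r ?mulNrn.
Qed.

Lemma rw_metric_tildeE p : rw_metric_tilde kappa R s p =
  diag_mx (\row_k (tilde_factor k (time p) * rw_coef p 0 k)).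
Proof.
apply/matrixP => a b; rewrite /rw_metric_tilde -scaler_sumr [LHS]mxE.
rewrite [X in X + _]mxE [X in - X]mxE [X in _ + X]mxE sum_sq_theta sq_theta0.
rewrite !mxE /tilde_factor.
have [->|a0] := eqVneq a ord0; rewrite ?mul0rn ?mulr0 ?addr0 ?oppr0 ?add0r.
  by rewrite mulrN1 mulNrn mulrnAr mulr1.
by rewrite mulrnAr.
Qed.

(** * Smoothness and nondegeneracy of the two metrics *)

Hypotheses (hI : open_interval I) (hRsmooth : smooth I R).
Hypotheses (hRneq0 : forall t, I t -> R t != 0).
Hypotheses (hs : forall t, I t -> 1 - s * R t ^+ 2 != 0).

Let oI : open I. Proof. by case: hI. Qed.

Lemma smooth_rw_factor (U : set point) : open U -> smooth U (rw_factor kappa).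
Proof.
move=> oU; apply: smoothD => //; first exact: smooth_cst.
apply: smoothM => //; first exact: smooth_cst.
apply: smooth_sum => // i; apply: smoothX => //; exact: smooth_coordinate.
Qed.

Lemma open_spacetime : open M.
Proof.
apply: openI.
  apply: open_comp => // p _; apply/differentiable_continuous.
  exact: differentiable_coord.
apply: (@open_comp _ _ (rw_factor kappa) [set x | 0 < x]); last exact: open_gt.
move=> p _; apply/differentiable_continuous.
exact: (smooth_rw_factor (@openT _) [::]).
Qed.

Let f (t : K) : K := 1 - s * R t ^+ 2.

Lemma smooth_projective_factor : smooth I f.
Proof.
rewrite /f; under eq_fun do rewrite -mulNr.
apply: smoothD => //; first exact: smooth_cst.
by apply: smoothM => //; [exact: smooth_cst|exact: smoothX].
Qed.

Lemma smooth_tilde_factor k : smooth I (tilde_factor k).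
Proof.
have sf := smooth_projective_factor.
rewrite /tilde_factor; case: eqP => _; apply: smoothV => //.
- by move=> t It; rewrite expf_neq0// hs.
- exact: smoothX.
Qed.

Lemma smooth_rw_coef k : smooth M (fun p => rw_coef p 0 k).
Proof.
have oM := open_spacetime; under eq_fun do rewrite mxE.
case: eqP => _; first exact: smooth_cst.
apply: smoothX => //; apply: smoothM => //.
  apply: (smooth_comp (J := I)) => //; first by move=> p [].
  exact: smooth_coordinate.
apply: smoothV => //; last exact: smooth_rw_factor.
by move=> p [_ w0]; rewrite gt_eqF.
Qed.

Lemma rw_coef_neq0 p k : M p -> rw_coef p 0 k != 0.
Proof.
move=> [It w0]; rewrite mxE; case: (k == ord0).
  by rewrite oppr_eq0 oner_eq0.
by rewrite expf_neq0// mulf_neq0 ?hRneq0// invr_eq0 gt_eqF.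
Qed.

Lemma tilde_factor_neq0 t k : I t -> tilde_factor k t != 0.
Proof.
by move=> It; rewrite /tilde_factor; case: (k == ord0);
  rewrite invr_eq0 ?expf_neq0 ?hs.
Qed.

Lemma pseudo_riemannian_diag (g : point -> 'M[K]_4) (d : point -> 'rV[K]_4) :
  (forall p, g p = diag_mx (d p)) -> (forall k, smooth M (fun p => d p 0 k)) ->
  (forall p k, M p -> d p 0 k != 0) -> pseudo_riemannian M g.
Proof.
move=> gE sd d0; split=> [|p Mp]; last first.
  rewrite gE tr_diag_mx; split=> //.
  by rewrite unitmxE det_diag unitfE; apply/prodf_neq0 => k _; exact: d0.
apply: smooth_mx => [|i j]; first exact: open_spacetime.
under eq_fun do rewrite gE mxE; have [_|_] := eqVneq i j; first exact: sd.
exact: (@smooth_cst _ _ M 0).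
Qed.

Lemma pseudo_riemannian_rw : pseudo_riemannian M (rw_metric kappa R).
Proof.
apply: pseudo_riemannian_diag rw_metricE smooth_rw_coef _ => p k.
exact: rw_coef_neq0.
Qed.

Lemma pseudo_riemannian_rw_tilde :
  pseudo_riemannian M (rw_metric_tilde kappa R s).
Proof.
have oM := open_spacetime.
apply: pseudo_riemannian_diag rw_metric_tildeE _ _ => [k|p k Mp].
  under eq_fun do rewrite mxE.
  apply: smoothM => //; last exact: smooth_rw_coef.
  apply: (smooth_comp (J := I)) => //.
  - by move=> p [].
  - exact: smooth_tilde_factor.
  - exact: smooth_coordinate.
by rewrite mxE mulf_neq0 ?rw_coef_neq0 ?tilde_factor_neq0//; case: Mp.
Qed.

(** * Derivatives of the metric coefficients *)

Lemma partial_rw_coef0 p i : partial i (fun q => rw_coef q 0 ord0) p = 0.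
Proof.
by rewrite /partial; under eq_fun do rewrite mxE; rewrite derive_cst.
Qed.

Lemma derive_constant_line (W : point -> K) v p :
  (forall h, W (h *: v + p) = W p) -> 'D_v W p = 0.
Proof.
move=> Wh; rewrite /derive (_ : (fun h => _) = cst 0) ?lim_cst//.
by apply/funext => h /=; rewrite Wh subrr scaler0.
Qed.

(** Moving along the time axis leaves the spatial coordinates fixed. *)
Lemma partial_time_rw_factor p :
  partial ord0 (fun q => (rw_factor kappa q) ^- 2) p = 0.
Proof.
apply: derive_constant_line => h; congr (_ ^- 2); rewrite /rw_factor.
congr (1 + _ * _); apply: eq_bigr => i _; rewrite !mxE.
by rewrite eq_sym (negPf (neq_lift _ _)) andbF mulr0 add0r.
Qed.

Lemma differentiable_rw_coef p k : M p ->
  differentiable (fun q => rw_coef q 0 k) p.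
Proof. exact: (smooth_rw_coef k [::]). Qed.

Lemma differentiable_R t : I t -> differentiable R t.
Proof. exact: (hRsmooth [::]). Qed.

Lemma derive_projective_factor t : I t -> 'D_1 f t = - (2 * s * R t * 'D_1 R t).
Proof.
move=> /differentiable_R/derivable1_diffP/derivableP dR.
rewrite (_ : f = cst 1 - s *: (R ^+ 2)); last by apply/funext => x.
rewrite derive_val /GRing.scale/=; ring.
Qed.

(** The factor is f^-n with n = 2 for time and n = 1 for space, so its logarithmic derivative is -n
    f'/f, where -f' = 2 s R R'. *)
Lemma derive_tilde_factor t k : I t -> 'D_1 (tilde_factor k) t =
  (if k == ord0 then 2 else 1) * (2 * s * R t * 'D_1 R t) / f t
  * tilde_factor k t.
Proof.
move=> It; have f0 : f t != 0 by exact: hs.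
have df : derivable f t 1.
  by apply/derivable1_diffP; exact: (smooth_projective_factor [::]).
rewrite /tilde_factor -/(f t); case: (k == ord0).
  rewrite (deriveV (f := f ^+ 2)); last exact: derivableX.
    rewrite deriveX// derive_projective_factor//.
    by rewrite /GRing.scale/= expr1 !fctE; field.
  by rewrite fctE expf_neq0.
change ('D_1 (fun y => (f y)^-1) t =
  1 * (2 * s * R t * 'D_1 R t) / f t * (f t)^-1).
rewrite (deriveV (f := f))// derive_projective_factor//.
by rewrite /GRing.scale/=; field.
Qed.

(** A spatial coefficient is R^2 times a function constant in time, hence has logarithmic time
    derivative 2 R'/R. *)
Lemma partial_time_rw_coef p k : M p -> k != ord0 ->
  partial ord0 (fun q => rw_coef q 0 k) p =
  2 * 'D_1 R (time p) / R (time p) * rw_coef p 0 k.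
Proof.
move=> Mp k0; have [It w0] := Mp.
have dRt : differentiable (R \o @time K) p.
  apply: differentiable_comp; first exact: differentiable_coord.
  exact: differentiable_R.
have DR : 'D_(delta_mx 0 ord0) (R \o @time K) p = 'D_1 R (time p).
  have := partial_time_comp ord0 (differentiable_R It).
  by rewrite eqxx mul1r.
have dw : differentiable (fun q => (rw_factor kappa q) ^- 2) p.
  apply: differentiableV; last by rewrite expf_neq0 ?gt_eqF.
  exact: (smoothX (@openT _) 2 (smooth_rw_factor (@openT _)) [::]).
rewrite /partial.
rewrite (_ : (fun q => _) =
    (R \o @time K) ^+ 2 * (fun q => (rw_factor kappa q) ^- 2)); last first.
  by apply/funext => q; rewrite mxE (negPf k0) exprMn exprVn.
rewrite deriveM; [|exact/derivableX/diff_derivable|exact: diff_derivable].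
rewrite [X in _ *: X + _](partial_time_rw_factor p) scaler0 add0r.
rewrite deriveX; last exact: diff_derivable.
rewrite DR mxE (negPf k0) /GRing.scale/= expr1.
by field; rewrite gt_eqF// hRneq0.
Qed.

Lemma partial_tilde_coef p i k : M p ->
  partial i (fun q => tilde_factor k (time q) * rw_coef q 0 k) p =
  tilde_factor k (time p) * partial i (fun q => rw_coef q 0 k) p
  + (i == ord0)%:R * 'D_1 (tilde_factor k) (time p) * rw_coef p 0 k.
Proof.
move=> Mp; have [It _] := Mp.
have dk : differentiable (tilde_factor k) (time p).
  exact: (smooth_tilde_factor k [::]).
have dkt : differentiable (tilde_factor k \o @time K) p.
  by apply: differentiable_comp dk; exact: differentiable_coord.
rewrite -partial_time_comp// {1}/partial.
rewrite (deriveM (f := tilde_factor k \o @time K)); last first.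
- exact/diff_derivable/differentiable_rw_coef.
- exact: diff_derivable.
by rewrite /GRing.scale/= (mulrC (rw_coef p 0 k)).
Qed.

(** As f depends on time alone, the one-form psi has only a time component, whence the deltas at
    [ord0]. The diagonal formula reduces the claim to [rw_christoffel_algebra], with the spatial
    derivatives of [rw_coef] left unevaluated. *)
Lemma christoffel_rw_tilde p k i j : M p ->
  christoffel (rw_metric_tilde kappa R s) p k i j =
  christoffel (rw_metric kappa R) p k i j - 'D_1 f (time p) / (2 * f (time p))
    * ((k == i)%:R * (j == ord0)%:R + (k == j)%:R * (i == ord0)%:R).
Proof.
move=> Mp; have [It _] := Mp.
have dE (l : 'I_4) :
    (fun q => (\row_k (tilde_factor k (time q) * rw_coef q 0 k)) 0 l) =
    (fun q => tilde_factor l (time q) * rw_coef q 0 l).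
  by apply/funext => q; rewrite mxE.
rewrite (christoffel_diag _ _ _ rw_metricE); last first.
  by move=> l; exact: rw_coef_neq0.
rewrite (christoffel_diag _ _ _ rw_metric_tildeE); last first.
  by move=> l; rewrite mxE mulf_neq0 ?rw_coef_neq0 ?tilde_factor_neq0.
rewrite !dE !partial_tilde_coef// !derive_tilde_factor//.
rewrite derive_projective_factor// mxE.
have R0 := hRneq0 It; have f0 : f (time p) != 0 := hs It.
have c0 l : rw_coef p 0 l != 0 by exact: rw_coef_neq0.
apply: (rw_christoffel_algebra (c := rw_coef p 0)
  (rho := fun l => tilde_factor l (time p))
  (D := fun i l => partial i (fun q => rw_coef q 0 l) p) k i j R0 f0) => //.
- by move=> l /negPf l0; rewrite /tilde_factor l0.
- by rewrite mxE.
- by move=> l; exact: partial_rw_coef0.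
- by move=> l; exact: partial_time_rw_coef.
Qed.

End RobertsonWalker.

Theorem theorem0p1 (K : realType) (kappa : K) (I : set K) (R : K -> K) (s : K)
    (hkappa : kappa = 1 \/ kappa = 0 \/ kappa = -1)
    (hI : open_interval I)
    (hRsmooth : smooth I R)
    (hRneq0 : forall t, I t -> R t != 0)
    (hs : forall t, I t -> 1 - s * R t ^+ 2 != 0) :
  same_unparametrised_geodesics (spacetime kappa I)
    (rw_metric kappa R) (rw_metric_tilde kappa R s).
Proof.
have oI := hI.1.
have chE := @christoffel_rw_tilde _ kappa _ _ _ hI hRsmooth hRneq0 hs.
have sf : smooth I (fun t => 1 - s * R t ^+ 2).
  exact: smooth_projective_factor.
split.
- exact: pseudo_riemannian_rw.
- exact: pseudo_riemannian_rw_tilde.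
- apply: (projective_change_reparametrise sf hs) => [p []//|p k i j].
  exact: chE.
- apply: (projective_change_reparametrise (I := I)
    (mu := fun t => (1 - s * R t ^+ 2)^-1)).
  + exact: (smoothV oI hs sf).
  + by move=> t It; rewrite invr_eq0 hs.
  + by move=> p [].
  + move=> p k i j Mp; have [It _] := Mp; have f0 := hs _ It.
    have df : derivable (fun t => 1 - s * R t ^+ 2) (time p) 1.
      by apply/derivable1_diffP; exact: (sf [::]).
    (* For mu = 1/f one has mu'/(2 mu) = -f'/(2f), so the new correction undoes the one in [chE]. *)
    rewrite chE// (deriveV (f := fun t => 1 - s * R t ^+ 2))// /GRing.scale/=.
    by field.
Qed.
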